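(* For every $\epsilon_X,\epsilon_Y\in(-1,1)$ the finite itineraries of the form $tie\to win/loss\to loss/win\to tie$ and of the form $tie\to loss/win\to win/loss\to tie$ are not attainable for $h$ sufficiently small; that is, there is $h_0>0$ such that for all $0<h<h_0$ no itinerary along edges of the heteroclinic network of either of these two forms is attainable for $h$.
   Context: System. For $\epsilon\in(-1,1)$ let $M(\epsilon)$ be the $3\times 3$ matrix with rows $(\tfrac23\epsilon,\,1-\tfrac13\epsilon,\,-1-\tfrac13\epsilon)$, $(-1-\tfrac13\epsilon,\,\tfrac23\epsilon,\,1-\tfrac13\epsilon)$, $(1-\tfrac13\epsilon,\,-1-\tfrac13\epsilon,\,\tfrac23\epsilon)$. Put $A=M(\epsilon_X)$, $B=M(\epsilon_Y)$. The system is $\dot x_i=x_i[(Ay)_i-x^TAy]$, $\dot y_j=y_j[(Bx)_j-y^TBx]$, with $x,y$ in the standard 2-simplex; eliminating $x_3=1-x_1-x_2$, $y_3=1-y_1-y_2$ one works in coordinates $(x_1,x_2,y_1,y_2)$ on $\Delta=\{x_1,x_2\ge0,\ x_1+x_2\le1,\ y_1,y_2\ge0,\ y_1+y_2\le1\}$. Network. Put $R=(1,0)$, $S=(0,1)$, $P=(0,0)$. The vertices are the nine equilibria $(V,U)$, $V,U\in\{R,S,P\}$. The edges are the 18 open straight segments, each a heteroclinic orbit in the given direction (writing $VU$ for $(V,U)$): $PP\to PS$, $PP\to SP$, $PS\to SS$, $PS\to RS$, $SS\to SR$, $SS\to RS$, $RS\to RR$, $RS\to RP$, $RP\to PP$,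 $RP\to SP$, $SP\to SS$, $SP\to SR$, $SR\to RR$, $SR\to PR$, $RR\to RP$, $RR\to PR$, $PR\to PP$, $PR\to PS$. Vertices are classified as tie: $PP,SS,RR$; win/loss: $SP,PR,RS$; loss/win: $PS,SR,RP$. Local coordinates. At a vertex $(V,U)$ use the affine coordinates $(z_1,z_2,z_3,z_4)$, where $(z_1,z_2)=(x_1,x_2)$ if $V=P$, $(x_1,-x_3)$ if $V=S$, $(-x_3,x_2)$ if $V=R$; and $(z_3,z_4)=(y_1,y_2)$ if $U=P$, $(y_1,-y_3)$ if $U=S$, $(-y_3,y_2)$ if $U=R$. In these the vertex is the origin and the linearization there is diagonal, $\dot z_j=\lambda_j z_j$. For an edge $v\to w$ there are a unique index $k$ and sign $s\in\{1,-1\}$ such that $w$ has $v$-coordinates $s e_k$ ($e_k$ the $k$-th standard basis vector); then $\lambda_k>0$ at $v$. Sections and maps. Let $0<h<1/2$. In $v$-coordinates, $\Sigma^{out}_{v\to w}=\{z_k=sh,\ |z_j|<h\ (j\ne k)\}$ and $\Sigma^{in}_{v\to w}=\{z_k=s(1-h),\ |z_j|<h\ (j\neq k)\}$. The local map $\Phi_{v\to w}$ is the transition of the linearized flow at $v$ to $\{z_k=sh\}$: for $sz_k>0$, $\Phi_{v\to w}(z)_j=z_j e^{\lambda_j t}$ with $t=\lambda_k^{-1}\ln(h/|z_k|)$. The global map $\Psi_{v\to w}$ from $\{z_k=sh\}$ to $\{z_k=s(1-h)\}$ is the transition map of the system linearized along the edge: writing $\tilde z$ for the three coordinates other than $z_k$,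 $\dot z_k=\zeta(z_k,\tilde z)$ and $\dot{\tilde z}=g(z_k,\tilde z)$, it sends $\tilde z(sh)$ to $\tilde z(s(1-h))$, where $d\tilde z/dz_k=\zeta(z_k,0)^{-1}\,\partial_{\tilde z}g(z_k,0)\,\tilde z$. $Tran_{v\to w}$ is the affine change from $v$-coordinates to $w$-coordinates. Attainability. An itinerary $v_1\to v_2\to\dots\to v_n$ along edges of the network is attainable for $h$ if there is a point $q_1\in\Sigma^{out}_{v_1\to v_2}$ belonging to $\Delta$ such that successively for $i=1,\dots,n-2$: $\Psi_{v_i\to v_{i+1}}(q_i)\in\Sigma^{in}_{v_i\to v_{i+1}}$, and $q_{i+1}:=\Phi_{v_{i+1}\to v_{i+2}}(Tran_{v_i\to v_{i+1}}(\Psi_{v_i\to v_{i+1}}(q_i)))$ is defined and lies in $\Sigma^{out}_{v_{i+1}\to v_{i+2}}$. *)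

(* Defs.v *)
From HB Require Import structures.
From mathcomp Require Import all_boot all_order all_algebra.
From mathcomp Require Import boolp classical_sets reals topology normedtype.
From mathcomp Require Import sequences derive exp.
From mathcomp Require Import ring lra.
Set Implicit Arguments.
Unset Strict Implicit.
Unset Printing Implicit Defensive.
Import Order.TTheory GRing.Theory Num.Theory.
Import numFieldNormedType.Exports.
Local Open Scope classical_set_scope.
Local Open Scope ring_scope.

Definition i1 : 'I_4 := @Ordinal 4 0 isT.
Definition i2 : 'I_4 := @Ordinal 4 1 isT.
Definition i3 : 'I_4 := @Ordinal 4 2 isT.
Definition i4 : 'I_4 := @Ordinal 4 3 isT.

Definition row4 (R : realType) (a b c d : R) : 'rV[R]_4 :=
  \row_(j < 4) nth 0 [:: a; b; c; d] j.

(* A phase point is the row (x_1, x_2, y_1, y_2); the third components of the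
   two mixed strategies are x_3 = 1 - x_1 - x_2 and y_3 = 1 - y_1 - y_2. *)
Definition Delta (R : realType) : set 'rV[R]_4 :=
  [set p | [/\ 0 <= p 0 i1, 0 <= p 0 i2 & p 0 i1 + p 0 i2 <= 1] /\
           [/\ 0 <= p 0 i3, 0 <= p 0 i4 & p 0 i3 + p 0 i4 <= 1]].

Definition simplex_pt (R : realType) (a b : R) : 'cV[R]_3 :=
  \col_(i < 3) nth 0 [:: a; b; 1 - a - b] i.

Definition payoff (R : realType) (e : R) : 'M[R]_3 :=
  \matrix_(i < 3, j < 3) nth 0 (nth [::]
    [:: [::   2 / 3 * e; 1 - 1 / 3 * e; -1 - 1 / 3 * e];
        [:: -1 - 1 / 3 * e;   2 / 3 * e; 1 - 1 / 3 * e];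
        [:: 1 - 1 / 3 * e; -1 - 1 / 3 * e;   2 / 3 * e]] i) j.

(* u_i ((M w)_i - u^T M w) *)
Definition replicator (R : realType) (M : 'M[R]_3) (u w : 'cV[R]_3) : 'cV[R]_3 :=
  \col_(i < 3) (u i 0 * ((M *m w) i 0 - (u^T *m M *m w) 0 0)).

Definition vector_field (R : realType) (eX eY : R) (p : 'rV[R]_4) : 'rV[R]_4 :=
  let x := simplex_pt (p 0 i1) (p 0 i2) in
  let y := simplex_pt (p 0 i3) (p 0 i4) in
  let dx := replicator (payoff eX) x y in
  let dy := replicator (payoff eY) y x in
  row4 (dx 0 0) (dx 1 0) (dy 0 0) (dy 1 0).

Inductive strategy := Rock | Scissors | Paper.

Definition vertex : Type := (strategy * strategy)%type.

Definition edge : rel vertex := fun v w =>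
  match v, w with
  | (Paper, Paper), (Paper, Scissors) | (Paper, Paper), (Scissors, Paper)
  | (Paper, Scissors), (Scissors, Scissors) | (Paper, Scissors), (Rock, Scissors)
  | (Scissors, Scissors), (Scissors, Rock) | (Scissors, Scissors), (Rock, Scissors)
  | (Rock, Scissors), (Rock, Rock) | (Rock, Scissors), (Rock, Paper)
  | (Rock, Paper), (Paper, Paper) | (Rock, Paper), (Scissors, Paper)
  | (Scissors, Paper), (Scissors, Scissors) | (Scissors, Paper), (Scissors, Rock)
  | (Scissors, Rock), (Rock, Rock) | (Scissors, Rock), (Paper, Rock)
  | (Rock, Rock), (Rock, Paper) | (Rock, Rock), (Paper, Rock)
  | (Paper, Rock), (Paper, Paper) | (Paper, Rock), (Paper, Scissors) => true
  | _, _ => false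
  end.

Inductive outcome := Tie | WinLoss | LossWin.

Definition vertex_class (v : vertex) : outcome :=
  match v with
  | (Paper, Paper) | (Scissors, Scissors) | (Rock, Rock) => Tie
  | (Scissors, Paper) | (Paper, Rock) | (Rock, Scissors) => WinLoss
  | (Paper, Scissors) | (Scissors, Rock) | (Rock, Paper) => LossWin
  end.

Definition strategy_pt (R : realType) (V : strategy) : R * R :=
  match V with Rock => (1, 0) | Scissors => (0, 1) | Paper => (0, 0) end.

Definition vertex_pt (R : realType) (v : vertex) : 'rV[R]_4 :=
  let V := strategy_pt R v.1 in let U := strategy_pt R v.2 in
  row4 V.1 V.2 U.1 U.2.

(* In [chart1] the expression - (1 - a - b) is minus the third component. *)
Definition chart1 (R : realType) (V : strategy) (a b : R) : R * R :=
  match V with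
  | Paper => (a, b)
  | Scissors => (a, - (1 - a - b))
  | Rock => (- (1 - a - b), b)
  end.

Definition unchart1 (R : realType) (V : strategy) (a b : R) : R * R :=
  match V with
  | Paper => (a, b)
  | Scissors => (a, 1 - a + b)
  | Rock => (1 - b + a, b)
  end.

Definition chart (R : realType) (v : vertex) (p : 'rV[R]_4) : 'rV[R]_4 :=
  let a := chart1 v.1 (p 0 i1) (p 0 i2) in
  let b := chart1 v.2 (p 0 i3) (p 0 i4) in
  row4 a.1 a.2 b.1 b.2.

Definition unchart (R : realType) (v : vertex) (z : 'rV[R]_4) : 'rV[R]_4 :=
  let a := unchart1 v.1 (z 0 i1) (z 0 i2) in
  let b := unchart1 v.2 (z 0 i3) (z 0 i4) in
  row4 a.1 a.2 b.1 b.2.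

Definition tran (R : realType) (v w : vertex) (z : 'rV[R]_4) : 'rV[R]_4 :=
  chart w (unchart v z).

(* The system in v-coordinates. The chart is affine, so a tangent vector f is
   transported by its linear part: f |-> chart v f - chart v 0. *)
Definition local_field (R : realType) (eX eY : R) (v : vertex) (z : 'rV[R]_4)
    : 'rV[R]_4 :=
  chart v (vector_field eX eY (unchart v z)) - chart v 0.

(* Partial derivative of the j-th component with respect to z_i, at z. *)
Definition local_partial (R : realType) (eX eY : R) (v : vertex) (j i : 'I_4)
    (z : 'rV[R]_4) : R :=
  'D_(delta_mx 0 i) (fun z' : 'rV[R]_4 => local_field eX eY v z' 0 j) z.

Definition eigval (R : realType) (eX eY : R) (v : vertex) (j : 'I_4) : R :=
  local_partial eX eY v j j 0.

(* For an edge v -> w, w has v-coordinates s e_k: k is the index of the only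
   nonzero coordinate and s is the value of that coordinate; see [edge_dirP]. *)
Definition edge_idx (R : realType) (v w : vertex) : 'I_4 :=
  odflt i1 [pick k | chart v (vertex_pt R w) 0 k != 0].

Definition edge_sgn (R : realType) (v w : vertex) : R :=
  chart v (vertex_pt R w) 0 (edge_idx R v w).

Definition Sigma_out (R : realType) (h : R) (v w : vertex) : set 'rV[R]_4 :=
  [set z | z 0 (edge_idx R v w) = edge_sgn R v w * h /\
           forall j, j != edge_idx R v w -> `|z 0 j| < h].

Definition Sigma_in (R : realType) (h : R) (v w : vertex) : set 'rV[R]_4 :=
  [set z | z 0 (edge_idx R v w) = edge_sgn R v w * (1 - h) /\
           forall j, j != edge_idx R v w -> `|z 0 j| < h].

Definition Phi_dom (R : realType) (v w : vertex) : set 'rV[R]_4 :=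
  [set z | 0 < edge_sgn R v w * z 0 (edge_idx R v w)].

Definition Phi (R : realType) (eX eY h : R) (v w : vertex) (z : 'rV[R]_4)
    : 'rV[R]_4 :=
  let k := edge_idx R v w in
  let t := (eigval eX eY v k)^-1 * ln (h / `|z 0 k|) in
  \row_j (z 0 j * expR (eigval eX eY v j * t)).

(* [Psi eX eY h v w z z'] is the graph of the global map: z' is the image of z.
   Z is a solution curve of the system linearized along the edge, parametrized
   by its own k-th coordinate, which runs through s r for r in [h, 1 - h]. *)
Definition Psi (R : realType) (eX eY h : R) (v w : vertex) (z z' : 'rV[R]_4)
    : Prop :=
  let k := edge_idx R v w in
  let s := edge_sgn R v w in
  exists Z : R -> 'rV[R]_4,
    [/\ Z (s * h) = z,
        Z (s * (1 - h)) = z' &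
        forall r : R, h <= r <= 1 - h ->
          let u := s * r in
          let base : 'rV[R]_4 := u *: delta_mx 0 k in
          Z u 0 k = u /\
          forall j, j != k ->
            is_derive u 1 (fun t : R => Z t 0 j)
              ((local_field eX eY v base 0 k)^-1 *
               \sum_(i < 4 | i != k) local_partial eX eY v j i base * Z u 0 i)].

(* q is on the out-section of v -> w, and the successive images of q can be
   followed along w and the remaining vertices of the itinerary. *)
Fixpoint followable (R : realType) (eX eY h : R) (v w : vertex)
    (rest : seq vertex) (q : 'rV[R]_4) : Prop :=
  Sigma_out h v w q /\
  if rest is u :: rest' then
    exists p : 'rV[R]_4,
      [/\ Psi eX eY h v w q p,
          Sigma_in h v w p,
          Phi_dom w u (tran v w p) &
          followable eX eY h w u rest' (Phi eX eY h w u (tran v w p))]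
  else True.

(* Attainability of the itinerary v1 -> v2 -> rest; the points of the sections
   are expressed in local coordinates, hence the [unchart]. *)
Definition attainable (R : realType) (eX eY h : R) (v1 v2 : vertex)
    (rest : seq vertex) : Prop :=
  exists2 q : 'rV[R]_4, Delta (unchart v1 q) & followable eX eY h v1 v2 rest q.

Lemma ord4P (P : 'I_4 -> Prop) : P i1 -> P i2 -> P i3 -> P i4 -> forall j, P j.
Proof.
move=> p1 p2 p3 p4 [[|[|[|[|//]]]] lt_j4].
- by rewrite (_ : Ordinal lt_j4 = i1) //; apply/val_inj.
- by rewrite (_ : Ordinal lt_j4 = i2) //; apply/val_inj.
- by rewrite (_ : Ordinal lt_j4 = i3) //; apply/val_inj.
- by rewrite (_ : Ordinal lt_j4 = i4) //; apply/val_inj.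
Qed.

Lemma chartK (R : realType) (v : vertex) : cancel (@chart R v) (@unchart R v).
Proof.
by move=> p; apply/rowP; case: v => -[] []; apply: ord4P;
  rewrite /unchart /chart !mxE /=; ring.
Qed.

Lemma unchartK (R : realType) (v : vertex) : cancel (@unchart R v) (@chart R v).
Proof.
by move=> p; apply/rowP; case: v => -[] []; apply: ord4P;
  rewrite /unchart /chart !mxE /=; ring.
Qed.

Lemma edge_dirP (R : realType) (v w : vertex) : edge v w ->
  (edge_sgn R v w = 1 \/ edge_sgn R v w = -1) /\
  forall (k : 'I_4) (s : R), s != 0 ->
    chart v (vertex_pt R w) = s *: delta_mx 0 k <->
    k = edge_idx R v w /\ s = edge_sgn R v w.
Proof.
move=> vw.
have uniq k' s' : s' != 0 -> chart v (vertex_pt R w) = s' *: delta_mx 0 k' ->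
    k' = edge_idx R v w /\ s' = edge_sgn R v w.
  move=> s'0 E.
  have k'E : k' = edge_idx R v w.
    rewrite /edge_idx; case: pickP => [j|/(_ k')]; rewrite E !mxE eqxx /=.
      by have [->//|] := eqVneq j k'; rewrite mulr0 eqxx.
    by rewrite eqxx mulr1 s'0.
  by split=> //; rewrite /edge_sgn -k'E E !mxE !eqxx mulr1.
suff [k' [s' [s'1 E]]] : exists k' (s' : R), (s' = 1 \/ s' = -1) /\
    chart v (vertex_pt R w) = s' *: delta_mx 0 k'.
  have s'0 : s' != 0 by case: s'1 => ->; rewrite ?oppr_eq0 oner_eq0.
  have [kE sE] := uniq _ _ s'0 E; rewrite -kE -sE.
  split=> // k s s0; split=> [/(uniq _ _ s0)[-> ->]|[-> ->]]; last exact: E.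
  by rewrite -kE -sE.
have E k' (s' : R) : s' = 1 \/ s' = -1 -> (forall j,
    chart v (vertex_pt R w) 0 j = s' * (j == k')%:R) ->
    exists k' (s' : R), (s' = 1 \/ s' = -1) /\
      chart v (vertex_pt R w) = s' *: delta_mx 0 k'.
  by move=> s'1 e; exists k', s'; split=> //; apply/rowP => j; rewrite e !mxE.
have n1 : (-1 : R) = 1 \/ (-1 : R) = -1 by right.
have p1 : (1 : R) = 1 \/ (1 : R) = -1 by left.
case: v w vw E {uniq} => [[] []] [[] []] //= _ E;
by first [ apply: (E i1 1 p1); apply: ord4P; rewrite !mxE /=; ring
         | apply: (E i2 1 p1); apply: ord4P; rewrite !mxE /=; ring
         | apply: (E i3 1 p1); apply: ord4P; rewrite !mxE /=; ring
         | apply: (E i4 1 p1); apply: ord4P; rewrite !mxE /=; ring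
         | apply: (E i1 (-1) n1); apply: ord4P; rewrite !mxE /=; ring
         | apply: (E i2 (-1) n1); apply: ord4P; rewrite !mxE /=; ring
         | apply: (E i3 (-1) n1); apply: ord4P; rewrite !mxE /=; ring
         | apply: (E i4 (-1) n1); apply: ord4P; rewrite !mxE /=; ring ].
Qed.

(* Main.v *)
Require Import Defs.
From mathcomp Require Import all_boot all_order all_algebra reals.
From mathcomp Require Import classical_sets topology normedtype.
From mathcomp Require Import sequences derive realfun exp ring lra.
Import Order.TTheory GRing.Theory Num.Theory.
Import numFieldNormedType.Exports.
Local Open Scope classical_set_scope.
Local Open Scope ring_scope.

(** The six itineraries are one itinerary up to symmetry. Let the tie be on
    the strategy a, let b beat a and let c beat b, so that a beats c. The
    player who leaves the tie, say p, first moves from a to b, then the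
    opponent moves from a to c, then p moves from b to c.

    Charts, signs and coordinate indices disappear when a point is described
    by the shares of the strategies. The share of a strategy has the
    logarithmic derivative [growth], which is affine along every edge.
    Therefore the global map along v -> w multiplies each transverse share by
    a power of (1 - h) / h whose exponent is the sum of the rates of growth at
    v and w divided by the rate of the moving strategy at v ([Psi_share]), and
    the local map multiplies it by a power of h over the share of the
    strategy that is about to be played ([Phi_share]).

    Let e be the incentive parameter of p and let X1 be the share of c in the
    population of p at the end of the first edge. Along this edge the share of
    c is contracted at least by h / (1 - h), so X1 <= h / 2 when h < 1 / 3, and
    the share of a there is h - X1, which is at least X1. Near the second
    vertex c and a decay at the rates -2 and -(1 - e), and the second edge
    multiplies c by a factor below 1 and a by a factor above 1: c loses more
    than a. Near the third vertex they grow at the rates 1 + e and 2: a grows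
    faster than c. When the share of c is back to h, the share of a is at
    least (h - X1) * (h / X1) >= h: the orbit has left the neighbourhood along
    the wrong strategy and misses the section of the edge to the tie. This
    computation is [overshoot], and [detour_blocked] applies it. It holds for
    all incentive parameters in (-1, 1), so every h < 1 / 3 will do. *)

(** * Players, strategies and shares *)

Definition strategy_index (c : strategy) : 'I_3 :=
  match c with
  | Rock => @Ordinal 3 0 isT
  | Scissors => @Ordinal 3 1 isT
  | Paper => @Ordinal 3 2 isT
  end.

(** A player is a boolean: [true] is the player with mixed strategy x. *)
Definition choice_of (v : vertex) (p : bool) : strategy :=
  if p then v.1 else v.2.

Definition deviate (v : vertex) (p : bool) (c : strategy) : vertex :=
  if p then (c, v.2) else (v.1, c).

Lemma choice_of_deviate v p c : choice_of (deviate v p c) p = c.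
Proof. by case: p. Qed.

Lemma choice_of_deviateN v p c :
  choice_of (deviate v p c) (~~ p) = choice_of v (~~ p).
Proof. by case: p. Qed.

Lemma edge_deviates v p c : edge v (deviate v p c) -> c <> choice_of v p.
Proof. by case: v => -[] []; case: p; case: c. Qed.

Section Shares.
Context {R : realType}.

Definition mixed (p : bool) (q : 'rV[R]_4) : 'cV[R]_3 :=
  if p then simplex_pt (q 0 i1) (q 0 i2) else simplex_pt (q 0 i3) (q 0 i4).

Definition share (p : bool) (c : strategy) (q : 'rV[R]_4) : R :=
  mixed p q (strategy_index c) 0.

(** The index of the coordinate of the chart at [v] that carries the share of
    [c] in the population of [p], and the sign that it carries there. The chart
    at a vertex omits the strategy that is played, and the third strategy,
    Paper, always enters with a minus sign, in the place of the omitted one. *)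
Definition slot (v : vertex) (p : bool) (c : strategy) : 'I_4 :=
  let first := match choice_of v p, c with
               | _, Rock | Rock, Paper => true
               | _, _ => false
               end in
  if p then if first then i1 else i2 else if first then i3 else i4.

Definition orient (c : strategy) : R := if c is Paper then -1 else 1.

Lemma orient_cases c : orient c = 1 \/ orient c = -1.
Proof. by case: c; [left | left | right]. Qed.

Lemma orientM c : orient c * orient c = 1.
Proof. by case: c; rewrite /= ?mulr1 ?mulrNN ?mulr1. Qed.

Lemma chart_slot v p c q : c <> choice_of v p ->
  chart v q 0 (slot v p c) = orient c * share p c q.
Proof.
by case: v => -[] []; case: p; case: c => // _;
  rewrite /share /slot /= !mxE /=; ring.
Qed.

Lemma local_slot v p c (z : 'rV[R]_4) : c <> choice_of v p ->
  z 0 (slot v p c) = orient c * share p c (unchart v z).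
Proof. by move=> cv; rewrite -(chart_slot _ _ _ _ cv) unchartK. Qed.

Lemma share_local v p c (z : 'rV[R]_4) : c <> choice_of v p ->
  share p c (unchart v z) = orient c * z 0 (slot v p c).
Proof. by move=> cv; rewrite (local_slot _ _ _ _ cv) mulrA orientM mul1r. Qed.

Lemma share_sum p q : share p Rock q + share p Scissors q + share p Paper q = 1.
Proof. by case: p; rewrite /share !mxE /=; ring. Qed.

Lemma mixed_sum p q : \sum_i mixed p q i 0 = 1.
Proof. by case: p; rewrite !big_ord_recl big_ord0 !mxE /=; ring. Qed.

Lemma mixed_affine p t (q1 q2 : 'rV[R]_4) :
  mixed p ((1 - t) *: q1 + t *: q2) = (1 - t) *: mixed p q1 + t *: mixed p q2.
Proof.
apply/colP => i; case: p; rewrite !mxE; case: i => -[|[|[|//]]] ? /=; ring.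
Qed.

Lemma mixed_vertex v p :
  mixed p (vertex_pt R v) = delta_mx (strategy_index (choice_of v p)) 0.
Proof.
apply/colP => -[[|[|[|//]]] ?]; case: v => -[] []; case: p;
rewrite !mxE /=; ring.
Qed.

Lemma unchart_affine v t (z1 z2 : 'rV[R]_4) :
  unchart v ((1 - t) *: z1 + t *: z2) =
    (1 - t) *: unchart v z1 + t *: unchart v z2.
Proof.
by apply/rowP; apply: ord4P; case: v => -[] []; rewrite !mxE /=; ring.
Qed.

Lemma unchart0 v : unchart v 0 = vertex_pt R v.
Proof.
by apply/rowP; apply: ord4P; case: v => -[] []; rewrite !mxE /=; ring.
Qed.

Lemma chart_vertex_deviate v p c : c <> choice_of v p ->
  chart v (vertex_pt R (deviate v p c)) = orient c *: delta_mx 0 (slot v p c).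
Proof.
by move=> cv; apply/rowP; move: cv;
 case: v => -[] []; case: p; case: c => // _; apply: ord4P;
 rewrite /slot /= !mxE /=; ring.
Qed.

Lemma edge_slot v p c : edge v (deviate v p c) ->
  edge_idx R v (deviate v p c) = slot v p c /\
  edge_sgn R v (deviate v p c) = orient c.
Proof.
move=> vw; have cv := edge_deviates v p c vw.
have o0 : orient c != 0 by case: (orient_cases c) => ->; rewrite ?oppr_eq0 oner_eq0.
have [_ E] := edge_dirP R vw.
by have [-> ->] := (E _ _ o0).1 (chart_vertex_deviate v p c cv).
Qed.

(** The two sections of an edge differ only in the value [l] of the share of
    the new strategy: it is h on the outgoing one, 1 - h on the incoming one. *)
Lemma section_share v p c (l h : R) (z : 'rV[R]_4) : edge v (deviate v p c) ->
  let k := edge_idx R v (deviate v p c) in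
  z 0 k = edge_sgn R v (deviate v p c) * l /\
    (forall j, j != k -> `|z 0 j| < h) ->
  share p c (unchart v z) = l /\
  forall p' c', c' <> choice_of v p' -> slot v p' c' != slot v p c ->
    `|share p' c' (unchart v z)| < h.
Proof.
move=> vw; have cv := edge_deviates v p c vw.
have [-> ->] := edge_slot v p c vw; move=> k [zk zj]; split.
  by rewrite share_local// zk mulrA orientM mul1r.
move=> p' c' cv' /zj; rewrite share_local//.
by case: (orient_cases c') => ->; rewrite ?mul1r// mulN1r normrN.
Qed.

Lemma share_tran p c v w (z : 'rV[R]_4) :
  share p c (unchart w (tran v w z)) = share p c (unchart v z).
Proof. by rewrite /tran chartK. Qed.

End Shares.

(** * Growth rates *)

Section Growth.
Context {R : realType}.
Variables eX eY : R.

Definition incentive (p : bool) : R := if p then eX else eY.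

Definition growth (p : bool) (c : strategy) (q : 'rV[R]_4) : R :=
  let M := payoff (incentive p) in
  (M *m mixed (~~ p) q) (strategy_index c) 0
  - ((mixed p q)^T *m M *m mixed (~~ p) q) 0 0.

Lemma replicator_sum (M : 'M[R]_3) (u w : 'cV[R]_3) : \sum_i u i 0 = 1 ->
  \sum_i replicator M u w i 0 = 0.
Proof.
move=> u1; under eq_bigr do rewrite mxE mulrBr.
by rewrite sumrB -mulr_suml u1 mul1r -mulmxA [(u^T *m _) 0 0]mxE;
  under [X in _ - X]eq_bigr do rewrite mxE; rewrite subrr.
Qed.

(** In every chart the system keeps the replicator form. A coordinate that
    carries the share of Paper is minus one plus the two other shares of that
    player, and its derivative has the right form because the replicator
    derivatives of the three shares add up to zero. *)
Lemma local_field_growth v p c (z : 'rV[R]_4) : c <> choice_of v p ->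
  local_field eX eY v z 0 (slot v p c) =
    z 0 (slot v p c) * growth p c (unchart v z).
Proof.
move=> cv; rewrite (local_slot v p c z cv) -mulrA; set q := unchart v z.
pose d p' := replicator (payoff (incentive p')) (mixed p' q) (mixed (~~ p') q).
have -> : share p c q * growth p c q = d p (strategy_index c) 0.
  by rewrite /d mxE.
have d0 p' : d p' (strategy_index Rock) 0 + d p' (strategy_index Scissors) 0
    + d p' (strategy_index Paper) 0 = 0.
  rewrite -[RHS](replicator_sum (payoff (incentive p')) _ (mixed (~~ p') q)
    (mixed_sum p' q)) !big_ord_recl big_ord0 addr0 addrA.
  by congr (d _ _ _ + d _ _ _ + d _ _ _); apply/val_inj.
have fE : vector_field eX eY q = row4
    (d true (strategy_index Rock) 0) (d true (strategy_index Scissors) 0)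
    (d false (strategy_index Rock) 0) (d false (strategy_index Scissors) 0).
  rewrite /vector_field; congr row4; congr (replicator _ _ _ _ _); exact/val_inj.
rewrite /local_field fE; move: (d0 true) (d0 false); move: d {d0 fE} => d dX dY.
by case: v cv @q => -[] []; case: p; case: c => // _ q;
  rewrite /slot /= !mxE /=; lra.
Qed.

(** The growth is affine in either mixed strategy when the other one is fixed;
    jointly it is not, whence the condition that one player does not move. *)
Lemma growth_affine p p' c t (q1 q2 : 'rV[R]_4) : mixed p' q1 = mixed p' q2 ->
  growth p c ((1 - t) *: q1 + t *: q2) =
    (1 - t) * growth p c q1 + t * growth p c q2.
Proof.
rewrite /growth !mixed_affine; set M := payoff _.
have [->|->] : p' = p \/ p' = ~~ p by case: (p) (p') => -[]; auto.
  move=> <-; rewrite -scalerDl subrK scale1r mulmxDr -!scalemxAr mulmxDr -!scalemxAr !mxE.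
  ring.
move=> <-; rewrite -scalerDl subrK scale1r linearD !linearZ /= !mulmxDl -!scalemxAl !mxE.
ring.
Qed.

Lemma unchart_axis v i (z : 'rV[R]_4) :
  exists p, mixed p (unchart v z) = mixed p (unchart v (delta_mx 0 i + z)).
Proof.
move: i; apply: ord4P; [exists false|exists false|exists true|exists true];
apply/colP => k; case: v => -[] []; rewrite /mixed !mxE /= ?add0r//.
Qed.

(** The hyperplane where a share vanishes is invariant, so on it the
    linearization of the equation of that share is diagonal. The derivative is
    taken directly as a limit: along an axis the field is the coordinate times
    an affine function. *)
Lemma local_partial_slot v p c i (z : 'rV[R]_4) : c <> choice_of v p ->
  z 0 (slot v p c) = 0 ->
  local_partial eX eY v (slot v p c) i z =
    (i == slot v p c)%:R * growth p c (unchart v z).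
Proof.
move=> cv zj; rewrite /local_partial /derive.
have [p' xE] := unchart_axis v i z.
set g := growth p c (unchart v z).
set D := growth p c (unchart v (delta_mx 0 i + z)) - g.
set del := (i == slot v p c)%:R : R.
apply: cvg_lim => //=.
suff : (fun t : R => del * (g + t * D)) @ 0^' --> del * g.
  apply: cvg_trans; apply: near_eq_cvg; near=> t.
  have t0 : t != 0 by near: t; exact: nbhs_dnbhs_neq.
  rewrite /= !local_field_growth// zj mul0r subr0 !mxE zj addr0.
  have -> : t *: delta_mx 0 i + z = (1 - t) *: z + t *: (delta_mx 0 i + z).
    by rewrite scalerDr scalerBl scale1r addrCA subrK.
  rewrite unchart_affine (growth_affine p p')// -/g eqxx /= [slot _ _ _ == _]eq_sym -/del.
  rewrite /GRing.scale /= /D; field => //.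
have : {for 0, continuous (fun t : R => del * (g + t * D))}.
  by apply: differentiable_continuous; exact/derivable1_diffP.
move=> /continuous_withinNx; rewrite mul0r addr0; apply: cvg_trans.
Unshelve. all: by end_near. Qed.

Definition rate v p c : R := growth p c (vertex_pt R v).

(** At a vertex the growth of [c] is what the player gains by switching to [c]
    against the pure strategy of the opponent. *)
Lemma rateE v p c : let M := payoff (incentive p) in
  let d := strategy_index (choice_of v (~~ p)) in
  rate v p c = M (strategy_index c) d - M (strategy_index (choice_of v p)) d.
Proof.
by rewrite /rate /growth !mixed_vertex trmx_delta -rowE -!colE !mxE.
Qed.

Lemma rate_own v p : rate v p (choice_of v p) = 0.
Proof. by rewrite rateE subrr. Qed.

Lemma eigval_slot v p c : c <> choice_of v p ->
  eigval eX eY v (slot v p c) = rate v p c.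
Proof.
move=> cv; rewrite /eigval local_partial_slot ?mxE// eqxx mul1r unchart0//.
Qed.

Lemma growth_edge v p c p' c' r : c <> choice_of v p ->
  growth p' c' (unchart v ((orient c * r) *: delta_mx 0 (slot v p c))) =
    (1 - r) * rate v p' c' + r * rate (deviate v p c) p' c'.
Proof.
move=> cv; rewrite mulrC -scalerA -(chart_vertex_deviate v p c cv).
rewrite -[r *: _]add0r -{1}(scaler0 _ (1 - r)) unchart_affine chartK unchart0.
by apply: (growth_affine _ (~~ p)); rewrite !mixed_vertex choice_of_deviateN.
Qed.

End Growth.

(** * The global and local maps on shares *)

(** The product of [f] with the integrating factor
    (1 - r) ^ b / r ^ a is constant. *)
Lemma log_linear_transition {R : realType} (f : R -> R) (a b h : R) :
  0 < h < 1 / 2 ->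
  (forall r, h <= r <= 1 - h ->
     is_derive r (1 : R) f ((a / r + b / (1 - r)) * f r)) ->
  f (1 - h) = f h * expR ((a + b) * ln ((1 - h) / h)).
Proof.
move=> /andP[h0 h2] fE.
pose E r : R := expR (b * ln (1 - r) - a * ln r).
have dE r : h <= r <= 1 - h -> is_derive r (1 : R) E (- (a / r + b / (1 - r)) * E r).
  move=> /andP[hr rh]; have r0 : 0 < r by lra.
  have r1 : 0 < 1 - r by lra.
  have d1 := is_derive1_ln r0; have d2 := is_derive1_ln r1.
  have d3 : is_derive r (1 : R) (fun x : R => 1 - x) (-1).
    by rewrite -[-1]add0r; exact: (is_deriveB (is_derive_cst (1 : R) r 1)).
  have d4 := @is_derive1_comp R (@ln R) (fun x : R => 1 - x) r _ _ d2 d3.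
  have d5 : is_derive r (1 : R) (fun x => b * ln (1 - x) - a * ln x)
      (- (a / r + b / (1 - r))).
    apply: (is_derive_eq (is_deriveB (is_deriveZ b d4) (is_deriveZ a d1))).
    by rewrite /GRing.scale /=; ring.
  have d6 := is_derive1_comp (is_derive_expR _) d5.
  by apply: (is_derive_eq d6); rewrite /GRing.scale /= mulrC.
have dF r : h <= r <= 1 - h -> is_derive r (1 : R) (fun x => f x * E x) 0.
  move=> hr; apply: (is_derive_eq (is_deriveM (fE r hr) (dE r hr))).
  by rewrite /GRing.scale /=; ring.
have [|r|r|x _ /eqP] := @MVT_segment R (fun x => f x * E x) (fun=> 0) h (1 - h).
- lra.
- by rewrite in_itv /= => /andP[? ?]; apply: dF; lra.
- apply/derivable_within_continuous => x; rewrite in_itv /= => hx.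
  by have [] := dF x hx.
rewrite mul0r subr_eq0 => /eqP.
rewrite /E (_ : 1 - (1 - h) = h); last ring.
move=> FE.
have -> : (a + b) * ln ((1 - h) / h) =
    (b * ln (1 - h) - a * ln h) - (b * ln h - a * ln (1 - h)).
  by rewrite ln_div ?posrE//; [ring|lra].
by rewrite expRD mulrA -FE expRN mulfK// gt_eqF ?expR_gt0.
Qed.

Section Maps.
Context {R : realType}.
Variables eX eY : R.
Local Notation rate := (rate eX eY).

(** The moving share r satisfies r' = kappa * r * (1 - r) on the edge, with
    kappa its rate at [v], because its growth is affine and vanishes at the
    other end. Dividing the growth of a transverse share by this and splitting
    into partial fractions gives the equation of [log_linear_transition]. *)
Lemma Psi_share v p c p' c' (h : R) (z z' : 'rV[R]_4) : edge v (deviate v p c) ->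
  c' <> choice_of v p' -> slot v p' c' != slot v p c ->
  rate v p c != 0 -> 0 < h < 1 / 2 ->
  Psi eX eY h v (deviate v p c) z z' ->
  share p' c' (unchart v z') = share p' c' (unchart v z) *
    expR ((rate v p' c' + rate (deviate v p c) p' c') / rate v p c
          * ln ((1 - h) / h)).
Proof.
move=> vw cv' jk k0 hh; have cv := edge_deviates v p c vw.
have [kE sE] := edge_slot (R:=R) v p c vw.
rewrite /Psi kE sE => -[Z [<- <- dZ]].
set s := orient c; set k := slot v p c; set j := slot v p' c'.
rewrite !share_local// -mulrA; congr (_ * _).
rewrite mulrDl.
apply: (log_linear_transition (fun r => Z (s * r) 0 j)) => // r hr.
have [_ /(_ j jk) dj] := dZ r hr.
have ds : is_derive r (1 : R) (fun x : R => s * x) s.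
  apply: (is_derive_eq (is_deriveZ s (is_derive_id r 1))).
  by rewrite /GRing.scale /= mulr1.
have dW := is_derive1_comp dj ds.
apply: (is_derive_eq dW).
have bj : ((orient c * r) *: delta_mx 0 k : 'rV[R]_4) 0 j = 0.
  by rewrite !mxE (negPf jk) mulr0.
rewrite (bigD1 j) //= big1 => [|i /andP[_ ij]]; last first.
  by rewrite local_partial_slot// (negPf ij) !mul0r.
rewrite local_partial_slot// eqxx mul1r addr0 local_field_growth//.
rewrite !mxE !eqxx mulr1.
have := rate_own eX eY (deviate v p c) p; rewrite choice_of_deviate => w0.
rewrite !growth_edge// w0 mulr0 addr0 -/s.
have s0 : s != 0.
  by rewrite /s; case: (orient_cases (R:=R) c) => ->; rewrite ?oppr_eq0 oner_eq0.
have [r0 r1] : r != 0 /\ 1 - r != 0.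
  by split; apply: lt0r_neq0; clear -hh hr; lra.
rewrite /GRing.scale /=; field.
by rewrite s0 k0 r0 r1.
Qed.

Lemma Phi_share v p c (h : R) (z : 'rV[R]_4) : edge v (deviate v p c) ->
  Phi_dom v (deviate v p c) z ->
  let s := share p c (unchart v z) in
  0 < s /\ forall p' c', c' <> choice_of v p' ->
    share p' c' (unchart v (Phi eX eY h v (deviate v p c) z)) =
    share p' c' (unchart v z) * expR (rate v p' c' * (ln (h / s) / rate v p c)).
Proof.
move=> vw; have cv := edge_deviates v p c vw.
rewrite /Phi_dom /Phi; have [-> ->] := edge_slot (R:=R) v p c vw.
move=> /= zk; rewrite share_local//; split=> // p' c' cv'.
rewrite !share_local// !mxE mulrA !eigval_slot//.
congr (_ * expR (_ * _)); rewrite mulrC; congr (ln (h / _) * _).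
rewrite -(gtr0_norm zk) normrM.
by case: (orient_cases (R:=R) c) => ->; rewrite ?normrN normr1 mul1r.
Qed.

End Maps.

(** * The obstruction *)

(** [X] is the share of c on the first section and [Y] the share of c in the
    population of the opponent at the end of the first edge; [X1] and [h - X1]
    are the shares of c and a there, [X3] and [W3] those at the end of the
    second edge; [t] and [ln (h / X3) / (1 + e)] are the times spent near the
    second and third vertices, at the ends of which the shares of c of the
    opponent and of the player are back to h. *)
Lemma overshoot {R : realType} (e h X Y : R) :
  -1 < e < 1 -> 0 < h < 1 / 3 -> 0 < Y < h -> `|X| < h ->
  let L := ln ((1 - h) / h) in
  let t := ln (h / Y) / 2 in
  let X1 := X * expR ((- (1 + e) + -2) / (1 - e) * L) in
  let X3 := X1 * expR (-2 * t) * expR ((-2 + (1 + e)) / 2 * L) in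
  let W3 := (h - X1) * expR (- (1 - e) * t) * expR ((- (1 - e) + 2) / 2 * L) in
  0 < X3 -> h <= W3 * expR (2 * (ln (h / X3) / (1 + e))).
Proof.
move=> /andP[e1 e2] /andP[h0 h3] /andP[Y0 Yh] Xh L t X1 X3 W3 X30.
have E0 x : 0 < expR x :> R by exact: expR_gt0.
have L0 : 0 < L.
  by rewrite ln_gt0// ltr_pdivlMr// mul1r; lra.
have t0 : 0 < t.
  by rewrite divr_gt0// ln_gt0// ltr_pdivlMr// mul1r.
have X10 : 0 < X1 by move: X30; rewrite /X3 !pmulr_lgt0.
have X1h : X1 <= h / 2.
  have X0 : 0 < X by move: X10; rewrite /X1 pmulr_lgt0.
  have : expR ((- (1 + e) + -2) / (1 - e) * L) <= expR (- L).
    rewrite ler_expR -[- L]mulN1r ler_pM2r// ler_pdivrMr; lra.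
  have h1 : 0 < 1 - h by lra.
  rewrite expRN lnK ?posrE ?divr_gt0// invf_div => le_E.
  have hh : h / (1 - h) <= 2^-1 by rewrite ler_pdivrMr; lra.
  have /ltW Xh' : X < h by rewrite -(gtr0_norm X0).
  by apply: ler_pM; rewrite ?(ltW X0) ?expR_ge0//; exact: le_trans le_E hh.
clearbody X1 t L.
have lnX : ln (h / X3) = ln (h / X1) + 2 * t + (1 - e) / 2 * L.
  by rewrite !ln_div ?posrE// /X3 !lnM ?posrE ?mulr_gt0// !expRK; field.
have l0 : 0 < ln (h / X1) by rewrite ln_gt0// ltr_pdivlMr// mul1r; lra.
have eL : 0 < (1 - e) / 2 * L by rewrite !mulr_gt0//; lra.
(* A share growing in proportion to that of c, from h - X1 >= X1, reaches h
   no later than c does. *)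
have X1W : h <= (h - X1) * (h / X1).
  by rewrite mulrCA ler_peMr ?(ltW h0)// ler_pdivlMr// mul1r; lra.
apply: (le_trans X1W); rewrite /W3 -!mulrA -!expRD.
apply: ler_pM; rewrite ?divr_ge0 ?(ltW h0) ?(ltW X10)//; first lra.
rewrite -[leLHS]lnK ?posrE ?divr_gt0// ler_expR.
(* As 2 > 1 + e, the share of a gains at least the factor h / X3. *)
have : ln (h / X3) <= 2 * (ln (h / X3) / (1 + e)).
  rewrite mulrCA ler_peMr//; first by rewrite lnX; lra.
  by rewrite ler_pdivlMr; lra.
rewrite lnX.
have : 0 < (1 + e) * t by rewrite mulr_gt0//; lra.
have : 0 < (1 + e) * L by rewrite mulr_gt0//; lra.
lra.
Qed.

Definition beat (c : strategy) : strategy :=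
  match c with Paper => Scissors | Scissors => Rock | Rock => Paper end.

Lemma beat3 c : beat (beat (beat c)) = c.
Proof. by case: c. Qed.

Section Detour.
Context {R : realType}.
Variables eX eY : R.
Local Notation rate := (rate eX eY).

Lemma payoff_tie (e : R) c :
  payoff e (strategy_index c) (strategy_index c) = 2 / 3 * e.
Proof. by case: c; rewrite mxE. Qed.

Lemma payoff_win (e : R) c :
  payoff e (strategy_index (beat c)) (strategy_index c) = 1 - 1 / 3 * e.
Proof. by case: c; rewrite mxE. Qed.

Lemma payoff_loss (e : R) c :
  payoff e (strategy_index c) (strategy_index (beat c)) = -1 - 1 / 3 * e.
Proof. by case: c; rewrite mxE. Qed.

Lemma share_cycle p c (q : 'rV[R]_4) :
  share p c q + share p (beat c) q + share p (beat (beat c)) q = 1.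
Proof. by rewrite -(share_sum p q); case: c => /=; ring. Qed.

Lemma detour_blocked (p : bool) (a : strategy) (h : R) (q : 'rV[R]_4) :
  -1 < eX < 1 -> -1 < eY < 1 -> 0 < h < 1 / 3 ->
  let b := beat a in let c := beat b in
  let v1 := (a, a) in let v2 := deviate v1 p b in
  let v3 := deviate v2 (~~ p) c in let v4 := deviate v3 p c in
  ~ followable eX eY h v1 v2 [:: v3; v4] q.
Proof.
move=> eX1 eY1 hh b c v1 v2 v3 v4.
have e1 : -1 < incentive eX eY p < 1 by rewrite /incentive; case: (p).
have ca : beat c = a by exact: beat3.
have edges : [/\ edge v1 v2, edge v2 v3 & edge v3 v4].
  by rewrite /v4 /v3 /v2 /v1 /c /b; case: (p); case: (a).
have [v1p v1n] : choice_of v1 p = a /\ choice_of v1 (~~ p) = a.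
  by rewrite /v1; case: (p).
have [v2p v2n] : choice_of v2 p = b /\ choice_of v2 (~~ p) = a.
  by rewrite /v2 /v1; case: (p).
have [v3p v3n] : choice_of v3 p = b /\ choice_of v3 (~~ p) = c.
  by rewrite /v3 /v2 /v1; case: (p).
have [ab bc ca'] : [/\ a <> b, c <> b & c <> a].
  by rewrite /c /b; case: (a).
have [n1 n2] : slot v1 p c != slot v1 p b /\
   (slot v2 p c != slot v2 (~~ p) c /\ slot v2 p a != slot v2 (~~ p) c).
  by rewrite /v2 /v1 /c /b; case: (p); case: (a).
have n3 : slot v3 p a != slot v3 p c by rewrite /v3 /v2 /v1 /c /b; case: (p); case: (a).
case: edges => ed1 ed2 ed3; case: n2 => n2c n2a.
move eE : (incentive eX eY p) e1 => e e1.
pose wl := (payoff_tie, payoff_win, payoff_loss).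
have r1b : rate v1 p b = 1 - e by rewrite rateE v1p v1n !wl eE; field.
(* Where [a] beats [c], it is written as [beat c]. *)
have r1c : rate v1 p c = - (1 + e).
  by rewrite rateE v1p v1n -{1}ca !wl ?eE; field.
have r2c : rate v2 p c = -2 by rewrite rateE v2p v2n -{1}ca !wl ?eE; field.
have r2a : rate v2 p a = - (1 - e) by rewrite rateE v2p v2n !wl ?eE; field.
have r2n : rate v2 (~~ p) c = 2 by rewrite rateE negbK v2p v2n !wl ?eE; field.
have r3c : rate v3 p c = 1 + e by rewrite rateE v3p v3n !wl ?eE; field.
have r3a : rate v3 p a = 2.
  by rewrite rateE v3p v3n -{1}ca !wl ?eE; field.
have h2 : 0 < h < 1 / 2 by lra.
move=> [out1 [z1 [psi1 in1 dom1 [out2 [z2 [psi2 in2 dom2 [out3 _]]]]]]].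
have [_ sm0] := section_share v1 p b h h q ed1 out1.
have [Xb1 sm1] := section_share v1 p b (1 - h) h z1 ed1 in1.
have [Y0 P2] := Phi_share eX eY v2 (~~ p) c h _ ed2 dom1.
have [X30 P3] := Phi_share eX eY v3 p c h _ ed3 dom2.
have [_ sm3] := section_share v3 p c h h _ ed3 out3.
have c1 : c <> choice_of v1 p by rewrite v1p.
have c2 : c <> choice_of v2 p by rewrite v2p.
have a2 : a <> choice_of v2 p by rewrite v2p.
have c1n : c <> choice_of v1 (~~ p) by rewrite v1n.
have a3 : a <> choice_of v3 p by rewrite v3p.
have k1 : rate v1 p b != 0 by rewrite r1b; apply: lt0r_neq0; clear -e1; lra.
have k2 : rate v2 (~~ p) c != 0 by rewrite r2n pnatr_eq0.
have n1n : slot v1 (~~ p) c != slot v1 p b.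
  by rewrite /v1 /c /b; case: (p); case: (a).
have Yh := sm1 _ _ c1n n1n; have Xh := sm0 _ _ c1 n1.
have T1 := Psi_share eX eY v1 p b p c h q z1 ed1 c1 n1 k1 h2 psi1.
rewrite -/v2 r1c r2c r1b in T1.
have Tc := Psi_share eX eY v2 (~~ p) c p c h _ z2 ed2 c2 n2c k2 h2 psi2.
have Ta := Psi_share eX eY v2 (~~ p) c p a h _ z2 ed2 a2 n2a k2 h2 psi2.
rewrite -/v3 r2c r3c r2n in Tc; rewrite -/v3 r2a r3a r2n in Ta.
have := sm3 _ _ a3 n3; rewrite P3// r3a r3c !share_tran Ta P2//.
move: X30; rewrite share_tran Tc P2//.
move: Y0 Yh; rewrite !share_tran r2n r2c r2a.
have Wa : share p a (unchart v1 z1) = h - share p c (unchart v1 z1).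
  by have := share_cycle p a (unchart v1 z1); rewrite -/b -/c Xb1; clear; lra.
rewrite Wa T1 => Y0 Yh X3.
have Yh' : 0 < share (~~ p) c (unchart v1 z1) < h.
  by rewrite Y0 -(gtr0_norm Y0).
by rewrite ltNge (le_trans (overshoot _ _ _ _ e1 hh Yh' Xh X3) (ler_norm _)).
Qed.

End Detour.

Lemma detour_shape v1 v2 v3 v4 : path edge v1 [:: v2; v3; v4] ->
  [/\ vertex_class v1 = Tie, vertex_class v2 = WinLoss,
      vertex_class v3 = LossWin & vertex_class v4 = Tie] \/
  [/\ vertex_class v1 = Tie, vertex_class v2 = LossWin,
      vertex_class v3 = WinLoss & vertex_class v4 = Tie] ->
  exists p a, let b := beat a in let c := beat b in
    [/\ v1 = (a, a), v2 = deviate v1 p b, v3 = deviate v2 (~~ p) c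
      & v4 = deviate v3 p c].
Proof.
move=> /= /and4P[e12 e23 e34 _] [] [c1 c2 c3 c4]; [exists true|exists false];
  exists v1.1; case: v1 c1 e12 => -[] [] // _; case: v2 c2 e23 => -[] [] // _;
  case: v3 c3 e34 => -[] [] // _; by case: v4 c4 => -[] [].
Qed.

Theorem theorem3 (R : realType) (eX eY : R) :
  -1 < eX < 1 -> -1 < eY < 1 ->
  exists h0 : R, 0 < h0 /\
    forall h : R, 0 < h < 1 / 2 -> h < h0 ->
    forall v1 v2 v3 v4 : vertex,
      path edge v1 [:: v2; v3; v4] ->
      [/\ vertex_class v1 = Tie, vertex_class v2 = WinLoss,
          vertex_class v3 = LossWin & vertex_class v4 = Tie] \/
      [/\ vertex_class v1 = Tie, vertex_class v2 = LossWin,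
          vertex_class v3 = WinLoss & vertex_class v4 = Tie] ->
      ~ attainable eX eY h v1 v2 [:: v3; v4].
Proof.
move=> eX1 eY1; exists (1 / 3); split; first lra.
move=> h /andP[h0 _] h3 v1 v2 v3 v4 vpath vclass.
have hh : 0 < h < 1 / 3 by rewrite h0.
have [p [a [-> -> -> ->]]] := detour_shape _ _ _ _ vpath vclass.
by case=> q _; exact: detour_blocked.
Qed.
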